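(* Let $G$ be a finite, simple, connected, undirected graph with $n=|V(G)|$ vertices, and consider the random walk on $G$ under the minimum degree weighting scheme. Then $\mathbf{H}[u,v]\le 6n^2$ for every pair of vertices $u,v\in V(G)$.
   Context: Minimum degree (min-deg) weighting scheme: each edge $(u,v)\in E(G)$ is given weight $w(u,v)=1/\min\{d(u),d(v)\}$, where $d(\cdot)$ is vertex degree in $G$. The weighted random walk moves from $u$ to a neighbour $v\in N(u)$ with probability $$P_{u,v}=\frac{1/\min\{d(u),d(v)\}}{\sum_{x\in N(u)}1/\min\{d(u),d(x)\}}.$$ $\mathbf{H}[u,v]$ is the hitting time: the expected number of steps for the walk started at $u$ to first visit $v$ ($\mathbf{H}[u,u]=0$). *)

(* Defs.v *)
From HB Require Import structures.
From mathcomp Require Import all_boot all_order all_algebra.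
From mathcomp Require Import all_classical all_reals all_analysis.

Set Implicit Arguments.
Unset Strict Implicit.
Unset Printing Implicit Defensive.

Import Order.TTheory GRing.Theory Num.Theory.
Local Open Scope classical_set_scope.
Local Open Scope ring_scope.

Section MinDegreeWalk.
Variables (R : realType) (V : finType) (e : rel V).

Definition simple_graph : Prop := symmetric e /\ irreflexive e.

Definition connected_graph : Prop := forall x y, connect e x y.

Definition degree (x : V) : nat := #|[pred y | e x y]|.

(* Only meaningful when [e x y] holds. *)
Definition mindeg_weight (x y : V) : R := (minn (degree x) (degree y))%:R^-1.

Definition mindeg_transition (x y : V) : R :=
  if e x y then mindeg_weight x y / \sum_(z | e x z) mindeg_weight x z else 0.

Section Process.
Context {disp : measure_display} {Omega : measurableType disp}.
Variables (P : probability Omega R) (X : nat -> Omega -> V).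

(* [X] is a Markov chain started at [u] with the min-degree transition
   probabilities.  The last clause is the Markov property
     P(X_(k+1) = x_(k+1) | X_i = x_i for i <= k) = p(x_k, x_(k+1))
   multiplied out, so that it also covers conditioning on null events.  The
   walk prescribes no step out of a vertex without neighbours; in a connected
   graph such a vertex exists only if it is the sole vertex. *)
Definition mindeg_walk (u : V) : Prop :=
  [/\ forall k x, measurable [set w | X k w = x],
      P [set w | X 0%N w = u] = 1%E
    & forall k (x : nat -> V), (0 < degree (x k))%N ->
        P [set w | forall i, (i <= k.+1)%N -> X i w = x i] =
        (P [set w | forall i, (i <= k)%N -> X i w = x i] *
           (mindeg_transition (x k) (x k.+1))%:E)%E].

(* The infimum is +oo if the trajectory never visits [v]. *)
Definition first_visit (v : V) (w : Omega) : \bar R :=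
  ereal_inf [set (k%:R)%:E | k in [set k : nat | X k w = v]].

(* The library's ['E_P[_]] only accepts real-valued variables, whereas
   [first_visit] may be infinite. *)
Definition hitting_time (v : V) : \bar R := (\int[P]_w first_visit v w)%E.

End Process.
End MinDegreeWalk.

(* Main.v *)
(** Write [c x y] for the edge weights, [c x] for their sum at [x], and [n] for
    the number of vertices.  Since [1 / min (d x) (d y) <= 1 / d x + 1 / d y],
    the conductances [c x] add up to at most [2 n].  The truncated mean hitting
    time [h x = E_x (min T N)] of [v] satisfies [h x <= 1 + sum_y p x y * h y]
    for [x <> v], that is, its net outflow [sum_y c x y * (h x - h y)] is at
    most [c x].  Summing over the level set [{z | h x <= h z}], which misses [v]
    when [h y < h x], only edges leaving the set contribute, all with the same
    sign, so [c x y * (h x - h y) <= 2 n] and hence [h x - h y <= 2 n * d x] for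
    every edge.  Along a geodesic to [v] the degrees add up to at most [3 n], as
    the neighbours of a vertex lie in three consecutive distance levels.  This
    bounds [h] by [6 n ^ 2], uniformly in [N]. *)

Require Import Defs.
From HB Require Import structures.
From mathcomp Require Import all_boot all_order all_algebra.
From mathcomp Require Import all_classical all_reals all_analysis.
From mathcomp Require Import lra zify measurable_realfun.

Set Implicit Arguments.
Unset Strict Implicit.
Unset Printing Implicit Defensive.

Import Order.TTheory GRing.Theory Num.Theory.
Local Open Scope ring_scope.

(** * Truncated mean hitting times *)

Section TruncatedHitting.
Variables (R : realFieldType) (V : finType) (p : V -> V -> R) (v : V).

(* The mean of [minn T N], where [T] is the hitting time of [v] from [x]. *)
Fixpoint truncated_hitting (N : nat) (x : V) : R :=
  if N is N'.+1 then
    if x == v then 0 else 1 + \sum_y p x y * truncated_hitting N' y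
  else 0.

Lemma truncated_hitting_target N : truncated_hitting N v = 0.
Proof. by case: N => //= N; rewrite eqxx. Qed.

Hypothesis p_ge0 : forall x y, 0 <= p x y.

Lemma truncated_hitting_ge0 N x : 0 <= truncated_hitting N x.
Proof.
elim: N x => [|N IHN] x //=; case: ifP => // _.
by rewrite addr_ge0 // sumr_ge0 // => y _; rewrite mulr_ge0.
Qed.

Lemma truncated_hittingS N x :
  truncated_hitting N x <= truncated_hitting N.+1 x.
Proof.
elim: N x => [|N IHN] x; first exact: truncated_hitting_ge0.
rewrite [leLHS]/= [leRHS]/=; case: ifP => // _.
by rewrite lerD2l ler_sum // => y _; rewrite ler_wpM2l.
Qed.

(** Monotonicity in the horizon trades [N.+1] for [N] on the left, so the flow argument deals with a
    single function. *)
Lemma truncated_hitting_subsolution N x : x != v ->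
  truncated_hitting N x <= 1 + \sum_y p x y * truncated_hitting N y.
Proof.
move=> /negPf xv; apply: le_trans (truncated_hittingS N x) _.
by rewrite /= xv.
Qed.

End TruncatedHitting.

(** * Flows in a network of symmetric conductances *)

Section Network.
Variables (R : realFieldType) (V : finType) (c : V -> V -> R).
Hypotheses (c_ge0 : forall x y, 0 <= c x y) (c_sym : forall x y, c x y = c y x).

(** By symmetry of [c], exchanging the two endpoints changes the sign of each term. *)
Lemma net_flow_inside (S : pred V) (h : V -> R) :
  \sum_(x | S x) \sum_(y | S y) c x y * (h x - h y) = 0.
Proof.
under eq_bigr do under eq_bigr do rewrite mulrBr.
under eq_bigr do rewrite sumrB.
rewrite sumrB [X in _ - X]exchange_big /=.
by apply/eqP; rewrite subr_eq0; apply/eqP; do 2!(apply: eq_bigr => ? _);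
  rewrite c_sym.
Qed.

Lemma edge_flow_le_level_set (h : V -> R) (x y : V) : h y < h x ->
  c x y * (h x - h y) <=
    \sum_(z | h x <= h z) \sum_t c z t * (h z - h t).
Proof.
move=> hyx; set S := fun z => h x <= h z.
have out_ge0 z t : S z -> ~~ S t -> 0 <= c z t * (h z - h t).
  rewrite /S -ltNge => Sz St.
  by rewrite mulr_ge0 // subr_ge0 ltW // (lt_le_trans St).
under eq_bigr do rewrite (bigID S) /=.
rewrite big_split /= net_flow_inside add0r (bigD1 x) /=; last exact: lexx.
rewrite (bigD1 y) /=; last by rewrite /S -ltNge.
rewrite -addrA lerDl addr_ge0 //.
  by apply: sumr_ge0 => t /andP[St _]; rewrite out_ge0 // /S.
by apply: sumr_ge0 => z /andP[Sz _]; apply: sumr_ge0 => t St; exact: out_ge0.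
Qed.

Variable v : V.

Let p x y := c x y / \sum_z c x z.

Lemma walk_ge0 x y : 0 <= p x y.
Proof. by rewrite divr_ge0 // sumr_ge0. Qed.

(** If the conductances at [x] sum to zero, each is zero by nonnegativity, which agrees with
    division by zero yielding zero. *)
Lemma mul_conductance_walk x y : (\sum_z c x z) * p x y = c x y.
Proof.
have [c0|cN0] := eqVneq (\sum_z c x z) 0; last by rewrite mulrC divfK.
rewrite c0 mul0r; apply/esym/eqP.
by move/eqP: c0; rewrite psumr_eq0 // => /allP; apply; rewrite mem_index_enum.
Qed.

Lemma truncated_hitting_edge N x y :
  c x y * (truncated_hitting p v N x - truncated_hitting p v N y) <=
    \sum_z \sum_t c z t.
Proof.
set h := truncated_hitting p v N.
have h_ge0 z : 0 <= h z := truncated_hitting_ge0 v walk_ge0 N z.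
have tot_ge0 (S : pred V) : 0 <= \sum_(z | S z) \sum_t c z t.
  by do 2!(apply: sumr_ge0 => ? _).
have [hxy|hyx] := leP (h x) (h y).
  by apply: le_trans (tot_ge0 predT); rewrite mulr_ge0_le0 // subr_le0.
apply: le_trans (edge_flow_le_level_set hyx) _.
rewrite [leRHS](bigID (fun z => h x <= h z)) /= ler_wpDr //.
apply: ler_sum => z hxz.
have zv : z != v.
  apply: contraTneq hxz => ->; rewrite -ltNge {1}/h truncated_hitting_target.
  exact: le_lt_trans hyx.
have := truncated_hitting_subsolution walk_ge0 N zv; rewrite -/h => hz.
under eq_bigr do rewrite mulrBr.
rewrite sumrB -mulr_suml lerBlDr.
have -> : \sum_t c z t * h t = (\sum_t c z t) * \sum_t p z t * h t.
  by rewrite mulr_sumr; apply: eq_bigr => t _; rewrite mulrA mul_conductance_walk.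
by rewrite -[X in X + _]mulr1 -mulrDr ler_wpM2l // sumr_ge0.
Qed.

End Network.

(** * Graph distance to the target *)

Section Distance.
Variables (V : finType) (e : rel V) (v : V).
Hypothesis e_conn : connected_graph e.

(** Tuples of fixed length keep the predicate boolean, as [ex_minn] requires. *)
Lemma has_walk_to x :
  exists k, [exists s : k.-tuple V, path e x s && (last x s == v)].
Proof.
have /connectP[s es vE] := e_conn x v.
by exists (size s); apply/existsP; exists (in_tuple s); rewrite es -vE eqxx.
Qed.

Definition dist_to x := ex_minn (has_walk_to x).

Lemma dist_to_le x (s : seq V) :
  path e x s -> last x s = v -> (dist_to x <= size s)%N.
Proof.
move=> es sv; rewrite /dist_to; case: ex_minnP => m _; apply.
by apply/existsP; exists (in_tuple s); rewrite es sv eqxx.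
Qed.

Lemma dist_toP x :
  exists2 s, path e x s & last x s = v /\ size s = dist_to x.
Proof.
rewrite /dist_to; case: ex_minnP => m /existsP[s /andP[es /eqP sv]] _.
by exists s => //; rewrite size_tuple.
Qed.

Lemma dist_to_edge x y : e x y -> (dist_to x <= (dist_to y).+1)%N.
Proof.
move=> exy; have [s es [sv <-]] := dist_toP y.
by apply: (@dist_to_le x (y :: s)); rewrite //= exy.
Qed.

Lemma dist_to_eq0 x : dist_to x = 0 -> x = v.
Proof. by move=> d0; have [[|y s] _ [] //] := dist_toP x; rewrite d0. Qed.

(** The tail of a shortest walk is itself shortest. *)
Lemma dist_to_closer x k :
  dist_to x = k.+1 -> exists2 y, e x y & dist_to y = k.
Proof.
move=> dx; have [[|y s] /= es [sv]] := dist_toP x; rewrite dx // => -[sk].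
case/andP: es => exy es; exists y => //; apply/eqP.
by rewrite eqn_leq -{1}sk dist_to_le // -ltnS -dx dist_to_edge.
Qed.

End Distance.

(** * Bounds for the min-degree weights *)

Section MinDegree.
Variables (R : realType) (V : finType) (e : rel V).
Hypotheses (e_simple : simple_graph e) (e_conn : connected_graph e).

Definition mindeg_conductance x y : R :=
  if e x y then mindeg_weight R e x y else 0.

Lemma mindeg_conductance_ge0 x y : 0 <= mindeg_conductance x y.
Proof. by rewrite /mindeg_conductance; case: ifP; rewrite ?invr_ge0. Qed.

Lemma mindeg_conductance_sym x y :
  mindeg_conductance x y = mindeg_conductance y x.
Proof.
by rewrite /mindeg_conductance e_simple.1 /mindeg_weight minnC.
Qed.

Lemma mindeg_transitionE x y : mindeg_transition R e x y =
  mindeg_conductance x y / \sum_z mindeg_conductance x z.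
Proof.
rewrite /mindeg_transition /mindeg_conductance -big_mkcond.
by case: ifP; rewrite ?mul0r.
Qed.

Lemma degree_gt0 x y : e x y -> (0 < degree e x)%N.
Proof. by move=> exy; apply/card_gt0P; exists y. Qed.

Lemma degree_gt0_neq x y : x != y -> (0 < degree e x)%N.
Proof.
move=> xy; have /connectP[[|z s] /= es yE] := e_conn x y.
  by rewrite yE eqxx in xy.
by case/andP: es => /degree_gt0.
Qed.

(** A vertex of positive degree contributes exactly 1, an isolated one 0. *)
Lemma sum_inv_degree_le :
  \sum_x \sum_(y | e x y) (degree e x)%:R^-1 <= #|V|%:R :> R.
Proof.
rewrite -sum1_card natr_sum; apply: ler_sum => x _.
rewrite sumr_const -[leLHS]mulr_natr -[#|_|]/(degree e x).
have [->|dN0] := eqVneq (degree e x) 0; first by rewrite mulr0.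
by rewrite mulVf // pnatr_eq0.
Qed.

Lemma total_mindeg_conductance_le :
  \sum_x \sum_y mindeg_conductance x y <= 2 * #|V|%:R.
Proof.
rewrite mulr_natl mulr2n.
apply: le_trans (lerD sum_inv_degree_le sum_inv_degree_le).
(* Swapping endpoints in one copy makes each edge carry the inverse degrees of both its ends. *)
rewrite [X in _ <= _ + X](exchange_big_dep predT) //= -big_split /=.
apply: ler_sum => x _; rewrite -big_mkcond /=.
under [X in _ <= _ + X]eq_bigl do rewrite e_simple.1.
rewrite -big_split; apply: ler_sum => y exy /=; rewrite /mindeg_weight.
by rewrite /minn; case: ifP => _; rewrite ?lerDl ?lerDr invr_ge0.
Qed.

Variable v : V.

Local Notation h := (truncated_hitting (mindeg_transition R e) v).

Lemma mindeg_hitting_edge N x y : e x y ->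
  h N x <= h N y + 2 * #|V|%:R * (degree e x)%:R.
Proof.
move=> exy; rewrite -lerBlDl.
have := truncated_hitting_edge mindeg_conductance_ge0 mindeg_conductance_sym
  v N x y.
have -> : truncated_hitting (fun x y => mindeg_conductance x y /
    \sum_z mindeg_conductance x z) v N = h N.
  congr (truncated_hitting _ v N).
  by apply/funext => a; apply/funext => b; rewrite mindeg_transitionE.
move=> /le_trans/(_ total_mindeg_conductance_le).
rewrite /mindeg_conductance exy /mindeg_weight mulrC.
have dx := degree_gt0 exy.
have dy : (0 < degree e y)%N by apply: (@degree_gt0 y x); rewrite e_simple.1.
rewrite ler_pdivrMr ?ltr0n ?leq_min ?dx // => /le_trans; apply.
by rewrite ler_wpM2l ?mulr_ge0 // ler_nat geq_minl.
Qed.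

Local Notation d := (dist_to v e_conn).
(** The levels [i - 1], [i] and [i + 1], which contain every neighbour of a vertex at distance
    [i]. *)
Local Notation near_level i := [pred z | (d z <= i.+1)%N && (i <= (d z).+1)%N].

(** Each step of a geodesic costs the degree of the vertex it leaves; the index starts at 1 because
    no step leaves [v]. *)
Lemma mindeg_hitting_dist N k x : d x = k ->
  h N x <= 2 * #|V|%:R * (\sum_(i < k) #|near_level i.+1|)%:R.
Proof.
elim: k x => [|k IHk] x dx.
  by rewrite (dist_to_eq0 dx) truncated_hitting_target big_ord0 mulr0.
have [y exy dy] := dist_to_closer dx.
apply: le_trans (mindeg_hitting_edge N exy) _.
rewrite big_ord_recr /= natrD mulrDr lerD ?IHk //.
rewrite ler_wpM2l ?mulr_ge0 // ler_nat; apply/subset_leq_card/fintype.subsetP => z.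
rewrite !inE => exz; rewrite -dx.
by rewrite dist_to_edge /= 1?e_simple.1 ?dist_to_edge.
Qed.

Lemma sum_near_level_le k : (\sum_(i < k) #|near_level i.+1| <= 3 * #|V|)%N.
Proof.
under eq_bigr do rewrite -sum1_card big_mkcond.
rewrite exchange_big /= mulnC -sum_nat_const; apply: leq_sum => z _.
rewrite -big_mkcond sum1_card.
rewrite -(size_image (fun i : 'I_k => i : nat)).
(* Double counting: [z] is counted only for those [i] with [i.+1] within 1 of [d z]. *)
apply: (@uniq_leq_size _ _ [:: d z; (d z).-1; (d z).-2]).
  by rewrite map_inj_uniq ?enum_uniq //; exact: val_inj.
move=> j /fintype.imageP[i + ->]; rewrite !inE.
lia.
Qed.

Lemma mindeg_hitting_le N x : h N x <= (6 * #|V| ^ 2)%:R.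
Proof.
apply: le_trans (mindeg_hitting_dist N erefl) _.
apply: (@le_trans _ _ (2 * #|V|%:R * (3 * #|V|)%:R)).
  by rewrite ler_wpM2l ?mulr_ge0 // ler_nat sum_near_level_le.
by rewrite !natrM; lra.
Qed.

End MinDegree.

(** * Cylinder events and the Markov property *)

Section Cylinders.
Local Open Scope classical_set_scope.
Variables (R : realType) (V : finType) (disp : measure_display).
Variables (Omega : measurableType disp) (P : probability Omega R).
Variable X : nat -> Omega -> V.
Hypothesis X_meas : forall k x, measurable [set w | X k w = x].

Definition cylinder (m : nat) (Q : nat -> pred V) : set Omega :=
  [set w | forall i, (i <= m)%N -> Q i (X i w)].

Lemma measurable_step k (Q : pred V) : measurable [set w | Q (X k w)].
Proof.
rewrite (_ : [set w | _] = \bigcup_(x in [set x | Q x]) [set w | X k w = x]).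
  by apply: fin_bigcup_measurable => // x _; exact: X_meas.
by apply/seteqP; split=> w /= => [Qw|[x /= Qx ->]//]; exists (X k w).
Qed.

Lemma measurable_cylinder m Q : measurable (cylinder m Q).
Proof.
rewrite (_ : cylinder m Q = \bigcap_(i in `I_m.+1) [set w | Q i (X i w)]).
  by apply: fin_bigcap_measurable => [|i _]; [exact: finite_II|exact: measurable_step].
by apply/seteqP; split=> w /= Qw i; exact: Qw.
Qed.

Lemma eq_cylinder m (Q Q' : nat -> pred V) :
  (forall i, (i <= m)%N -> Q i =1 Q' i) -> cylinder m Q = cylinder m Q'.
Proof.
by move=> QQ'; apply/seteqP; split=> w Qw i im; have := Qw i im; rewrite QQ'.
Qed.

Definition cylinder_prob m Q : R := fine (P (cylinder m Q)).

Lemma cylinder_probE m Q : (cylinder_prob m Q)%:E = P (cylinder m Q).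
Proof. by rewrite fineK // fin_num_measure //; exact: measurable_cylinder. Qed.

Definition pin (Q : nat -> pred V) (j : nat) y : nat -> pred V :=
  fun i => if i == j then pred1 y : pred V else Q i.

Lemma cylinder_prob_split m j Q : (j <= m)%N ->
  cylinder_prob m Q = \sum_(y | Q j y) cylinder_prob m (pin Q j y).
Proof.
move=> jm; apply: EFin_inj; rewrite -sumEFin cylinder_probE.
under eq_bigr do rewrite cylinder_probE.
have -> : cylinder m Q = \bigcup_(y in [set` Q j]) cylinder m (pin Q j y).
  apply/seteqP; split=> w.
    move=> Qw; exists (X j w); first exact: Qw.
    move=> i im; rewrite /pin; case: eqP => [->|_]; [exact: eqxx|exact: Qw].
  move=> [y Qy Hw] i im; have := Hw i im; rewrite /pin.
  by case: eqP => // -> /eqP ->.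
rewrite measure_fin_bigcup //.
- rewrite -[RHS]big_enum [RHS]fsbig_seq ?enum_uniq //.
  rewrite (_ : [set` enum (Q j)] = [set` Q j]) //.
  by apply/seteqP; split=> y /=; rewrite mem_enum.
- move=> y z _ _ [w [Hy Hz]]; have := Hy j jm; have := Hz j jm.
  by rewrite /pin eqxx => /eqP <- /eqP <-.
- by move=> y _; exact: measurable_cylinder.
Qed.

Variable p : V -> V -> R.
Variable active : pred V.
Hypothesis X_markov : forall k (x : nat -> V), active (x k) ->
  P [set w | forall i, (i <= k.+1)%N -> X i w = x i] =
  (P [set w | forall i, (i <= k)%N -> X i w = x i] * (p (x k) (x k.+1))%:E)%E.

(* The Markov property is assumed for single trajectories.  Pinning the
   coordinates below [k] one by one reduces a cylinder to that case. *)
Lemma cylinder_markov k (Q : nat -> pred V) x y : active x ->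
  Q k =1 pred1 x -> Q k.+1 =1 pred1 y ->
  cylinder_prob k.+1 Q = cylinder_prob k Q * p x y.
Proof.
move=> ax Qk Qk1.
(* Invariant: every coordinate from [j] to [k.+1] is a singleton, so [j = 0] leaves a single
   trajectory. *)
suff pinned j : (j <= k)%N ->
    (forall i, (i < j)%N \/ (exists a, Q i =1 pred1 a) \/ (k.+1 < i)%N) ->
    cylinder_prob k.+1 Q = cylinder_prob k Q * p x y.
  apply: (pinned k) => // i.
  case: (ltngtP i k) => [|ki|->]; [by left| |by right; left; exists x].
  by case: (ltngtP i k.+1) => [|ki1|->];
    [lia|by right; right|by right; left; exists y].
elim: j Q Qk Qk1 => [|j IHj] Q Qk Qk1 jk Qpin.
  (* The default [x] can occur only after time [k.+1], where the events do not look. *)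
  pose s i := if [pick a | Q i a] is Some a then a else x.
  have Qs i : (i <= k.+1)%N -> Q i =1 pred1 (s i).
    move=> ik; have [//|[[a Qa]|]] := Qpin i; last by rewrite ltnNge ik.
    rewrite /s; case: pickP => [b|/(_ a)]; last by rewrite Qa /= eqxx.
    by rewrite Qa => /eqP -> t; rewrite Qa.
  have cylE m : (m <= k.+1)%N ->
      cylinder m Q = [set w | forall i, (i <= m)%N -> X i w = s i].
    move=> mk; apply/seteqP; split=> w Hw i im; have := Hw i im.
      by rewrite Qs ?(leq_trans im) // => /eqP.
    by move=> ->; rewrite Qs ?(leq_trans im) //=.
  have sk : s k = x by apply/eqP; rewrite -[_ == _]Qk Qs //=.
  have sk1 : s k.+1 = y by apply/eqP; rewrite -[_ == _]Qk1 Qs //=.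
  have := @X_markov k s; rewrite sk sk1 -!cylE // => /(_ ax) PE.
  by apply: EFin_inj; rewrite EFinM !cylinder_probE.
rewrite (@cylinder_prob_split k.+1 j) 1?(@cylinder_prob_split k j); try lia.
rewrite mulr_suml; apply: eq_bigr => z _; apply: IHj.
- by rewrite /pin; case: eqP => [|//]; lia.
- by rewrite /pin; case: eqP => [|//]; lia.
- exact: ltnW.
move=> i; rewrite /pin; case: eqP => [_|ij]; first by right; left; exists z.
by case: (Qpin i) => [|[]]; [left; lia|right; left|right; right].
Qed.

(** * Survival probabilities and the tail-sum formula *)

Variable v : V.
Hypothesis active_off : forall x, x != v -> active x.

Let avoid : nat -> pred V := fun=> predC1 v.

Definition survival k : R := cylinder_prob k avoid.

Lemma survival_sum k :
  survival k = \sum_(x | x != v) cylinder_prob k (pin avoid k x).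
Proof. exact: cylinder_prob_split. Qed.

(** Split by the position at time [k]; the Markov property applies there since that position differs
    from [v]. *)
Lemma survival_step k y : y != v ->
  cylinder_prob k.+1 (pin avoid k.+1 y) =
  \sum_(x | x != v) cylinder_prob k (pin avoid k x) * p x y.
Proof.
move=> yv; rewrite (@cylinder_prob_split _ k) //.
have kk1 : (k == k.+1) = false by lia.
rewrite {1}/pin kk1; apply: eq_bigr => x xv.
rewrite (@cylinder_markov k _ x y) ?active_off //.
- congr (fine (P _) * _); apply: eq_cylinder => i ik t; rewrite /pin.
  by have -> : (i == k.+1) = false by lia.
- by move=> t; rewrite /pin eqxx.
- by move=> t; rewrite /pin eq_sym kk1 eqxx.
Qed.

(* Conditioning on the position after each further step, the partial sums of
   [P (T > k) = survival k] unfold the recursion of [truncated_hitting]. *)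
Lemma sum_survival N : \sum_(k < N) survival k =
  \sum_(x | x != v) cylinder_prob 0 (pin avoid 0 x) * truncated_hitting p v N x.
Proof.
(* The starting time is generalised because the induction on [N] advances it by one. *)
suff shifted j : \sum_(k < N) survival (j + k)%N = \sum_(x | x != v)
    cylinder_prob j (pin avoid j x) * truncated_hitting p v N x by exact: (shifted 0%N).
elim: N j => [|N IHN] j; first by rewrite big_ord0 big1 // => x _; rewrite mulr0.
rewrite big_ord_recl addn0.
under [X in _ + X]eq_bigr do rewrite /= addnS -addSn.
rewrite IHN survival_sum.
under [X in _ + X]eq_bigr => y yv do rewrite survival_step // mulr_suml.
rewrite exchange_big -big_split; apply: eq_bigr => x xv /=.
rewrite (negPf xv) mulrDr mulr1; congr (_ + _).
(* The recursion also sums over [y = v], a term that vanishes. *)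
rewrite mulr_sumr [in RHS](bigD1 v) //= truncated_hitting_target !mulr0 add0r.
by apply: eq_bigr => y _; rewrite mulrA.
Qed.

Variable u : V.
Hypothesis X_start : P [set w | X 0 w = u] = 1%E.

Lemma start_prob x : cylinder_prob 0 (pin avoid 0 x) = (x == u)%:R.
Proof.
apply: EFin_inj; rewrite cylinder_probE.
have cylE : cylinder 0 (pin avoid 0 x) = [set w | X 0 w = x].
  apply/seteqP; split=> w => [/(_ 0%N isT)/eqP//|/= Xw i].
  by rewrite leqn0 /pin => /eqP ->; rewrite eqxx /= Xw.
rewrite cylE; case: eqP => [-> //|xu].
apply/eqP; rewrite eq_le measure_ge0 andbT.
(* For [x] other than [u], the event lies in the complement of an event of probability one. *)
apply: (@le_trans _ _ (P (~` [set w | X 0 w = u]))); last first.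
  by rewrite probability_setC // X_start subee.
apply: le_measure; rewrite ?inE; try exact: X_meas.
  exact: measurableC.
by move=> w /= ->.
Qed.

Lemma sum_survivalE N : u != v ->
  \sum_(k < N) survival k = truncated_hitting p v N u.
Proof.
move=> uv; rewrite sum_survival (bigD1 u) //= start_prob eqxx mul1r big1 ?addr0 //.
by move=> x /andP[_ /negPf xu]; rewrite start_prob xu mul0r.
Qed.

(** The first visit time [T] is the number of [k] with [k < T], even when it is infinite. *)
Lemma first_visit_series w :
  first_visit R X v w = (\sum_(k <oo) (\1_(cylinder k avoid) w)%:E)%E.
Proof.
pose f k : \bar R := (\1_(cylinder k avoid) w)%:E; rewrite -[RHS]/(\sum_(k <oo) f k)%E.
have f_ge0 k : (0 <= f k)%E by rewrite lee_fin.
have [hit|never] := pselect (exists k, X k w == v).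
  have [m /eqP Xm mmin] := ex_minnP hit.
  have f1 k : (k < m)%N -> f k = 1%E.
    move=> km; rewrite /f indicE mem_set // => i ik.
    by apply: contraTN km => /mmin; lia.
  have f0 k : (m <= k)%N -> f k = 0%E.
    move=> mk; rewrite /f indicE memNset // => /(_ m mk).
    by rewrite /avoid Xm /= eqxx.
  have -> : first_visit R X v w = m%:R%:E.
    apply/eqP; rewrite eq_le; apply/andP; split.
      by apply: ereal_inf_lbound; exists m.
    apply: le_ereal_inf_tmp => _ [k /= Xk <-].
    by rewrite lee_fin ler_nat mmin //; exact/eqP.
  rewrite (@nneseries_split _ _ 0 m) // add0n.
  rewrite eseries0; last by move=> i mi _; exact: f0.
  rewrite adde0 (eq_big_nat _ _ (F2 := fun=> 1%E)) => [|i /andP[_]]; last exact: f1.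
  by rewrite sumEFin sumr_const_nat subn0.
have never' k : X k w != v.
  by apply/negP => Xk; apply: never; exists k.
have f1 k : f k = 1%E by rewrite /f indicE mem_set // => i _; exact: never'.
have -> : first_visit R X v w = +oo%E.
  apply/ereal_inf_pinfty => _ [k /= Xk <-].
  by have := never' k; rewrite Xk eqxx.
apply/esym/eqyP => A A0.
apply: le_trans (@nneseries_lim_ge _ f xpredT 0 (Num.bound A) _) => //.
rewrite (eq_bigr (fun=> 1%E)) => [|k _]; last exact: f1.
by rewrite sumEFin sumr_const_nat subn0 lee_fin ltW // archi_boundP // ltW.
Qed.

(** Integrating the nonnegative series termwise gives the mean as the sum of the tails
    [P (T > k)]. *)
Lemma hitting_time_series : hitting_time P X v = (\sum_(k <oo) (survival k)%:E)%E.
Proof.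
rewrite /hitting_time; under eq_integral do rewrite first_visit_series.
rewrite integral_nneseries //.
- apply: eq_eseriesr => k _.
  by rewrite integral_indic ?setIT ?cylinder_probE //; exact: measurable_cylinder.
- move=> k; apply/measurable_EFinP/measurable_indic; exact: measurable_cylinder.
Qed.

Lemma hitting_time_le (b : R) : 0 <= b ->
  (u != v -> forall N, truncated_hitting p v N u <= b) ->
  (hitting_time P X v <= b%:E)%E.
Proof.
move=> b0 hb; rewrite hitting_time_series.
apply: lime_le.
  by apply: is_cvg_nneseries => k _ _; rewrite lee_fin fine_ge0.
apply: nearW => N; rewrite sumEFin big_mkord lee_fin.
(* If the walk starts at the target, every survival probability is zero. *)
have [uv|uv] := eqVneq u v; last by rewrite sum_survivalE // hb.
rewrite sum_survival big1 // => x xv.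
by rewrite start_prob uv (negPf xv) mul0r.
Qed.

End Cylinders.

Theorem theorem68 (R : realType) (V : finType) (e : rel V)
    (Gsimple : simple_graph e) (Gconnected : connected_graph e)
    (disp : measure_display) (Omega : measurableType disp)
    (P : probability Omega R) (X : nat -> Omega -> V) (u v : V)
    (Xwalk : mindeg_walk e P X u) :
  (hitting_time P X v <= ((6 * #|V| ^ 2)%N%:R)%:E)%E.
Proof.
have [X_meas X_start X_markov] := Xwalk.
apply: (hitting_time_le (p := mindeg_transition R e)
  (active := fun x => (0 < degree e x)%N) X_meas X_markov _ X_start) => //.
  (* Connectedness gives every vertex other than [v] a neighbour, so the Markov clause covers it. *)
  by move=> x; exact: degree_gt0_neq.
by move=> _ N; exact: mindeg_hitting_le.
Qed.
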